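(* There is an algorithm that, given an instance of the game Blizzard (a finite graph $G$, a set of exits, and a starting vertex), decides in time linear in the size of $G$ which player has a winning strategy.
   Context: Blizzard is a two-player game. An instance consists of a finite graph $G=(V,E)$, a set $X\subseteq V$ of vertices called exits (shelters), and a starting vertex $s$ for the first player, the trapper. The game proceeds in rounds: in each round the trapper first moves from his current vertex to an adjacent vertex along an edge still present; then the second player, the Storm, permanently deletes one edge that is incident with the trapper's current vertex. The trapper wins if he reaches an exit; the Storm wins if the trapper ends up in a connected component of the current graph containing no exit. *)

(* Defs.v *)
From mathcomp Require Import all_boot.
Set Implicit Arguments.
Unset Strict Implicit.
Unset Printing Implicit Defensive.

(* Finite simple graphs: an edge is a two-element set of vertices. *)
Record graph := Graph {
  vertex : finType;
  edges : {set {set vertex}};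
  edges_card2 : forall e, e \in edges -> #|e| = 2 }.

Definition graph_size (G : graph) : nat := #|vertex G| + #|edges G|.

Record instance := Instance {
  board : graph;
  exits : {set vertex board};
  start : vertex board }.

Inductive player := Trapper | Storm.

Section Game.
Variable I : instance.
Local Notation V := (vertex (board I)).

(* [turn p] is the player to move in [p]; one round is a move of the trapper
   followed by a move of the Storm. *)
Record position := Position {
  turn : player;
  place : V;
  present : {set {set V}} }.

Definition initial : position :=
  Position Trapper (start I) (edges (board I)).

Definition move (p q : position) : Prop :=
  match turn p with
  | Trapper => exists2 v, [set place p; v] \in present p &
                 q = Position Storm v (present p)
  | Storm => exists e, [/\ e \in present p, place p \in e &
                 q = Position Trapper (place p) (present p :\ e)]
  end.

Definition reachable (p : position) (v : V) : bool :=
  connect (fun x y => [set x; y] \in present p) (place p) v.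

Definition won (P : player) (p : position) : bool :=
  match P with
  | Trapper => place p \in exits I
  | Storm => [forall x in exits I, ~~ reachable p x]
  end.

Definition over (p : position) : bool := won Trapper p || won Storm p.

(* A strategy sees the earlier positions, in chronological order, and the
   current one, and names the next position. *)
Definition strategy := seq position -> position -> position.

(* [play P f h p]: some play in which [P] follows [f] passes through the
   positions [h] and then reaches [p]; play stops once the game is over. *)
Inductive play (P : player) (f : strategy) : seq position -> position -> Prop :=
| play_initial : play P f [::] initial
| play_move h p q :
    play P f h p -> ~~ over p -> move p q -> (turn p = P -> q = f h p) ->
    play P f (rcons h p) q.

(* Every round deletes an edge, so there are no infinite plays, and it is
   enough to require that [f] always provides a legal move and that the plays
   following [f] that are over are won by [P]. *)
Definition winning_strategy (P : player) (f : strategy) : Prop :=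
  (forall h p, play P f h p -> ~~ over p -> turn p = P -> move p (f h p)) /\
  (forall h p, play P f h p -> over p -> won P p).

Definition has_winning_strategy (P : player) : Prop :=
  exists f, winning_strategy P f.

End Game.

(* A word RAM: a program uses finitely many registers, named by constants, and
   addresses the memory through the contents of registers.  Each instruction
   takes unit time; subtraction is truncated. *)
Inductive instruction :=
| Const of nat & nat
| Add of nat & nat & nat
| Sub of nat & nat & nat
| Read of nat & nat
| Write of nat & nat
| JumpZero of nat & nat
| Halt.

Definition program := seq instruction.

Record config := Config {
  line : nat;
  reg : nat -> nat;
  mem : nat -> nat }.

Definition update (f : nat -> nat) (i k : nat) : nat -> nat :=
  fun j => if j == i then k else f j.

Definition current (prog : program) (c : config) : instruction :=
  nth Halt prog (line c).

Definition step (prog : program) (c : config) : config :=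
  let: Config l R M := c in
  match current prog c with
  | Const r k => Config l.+1 (update R r k) M
  | Add r a b => Config l.+1 (update R r (R a + R b)) M
  | Sub r a b => Config l.+1 (update R r (R a - R b)) M
  | Read r a => Config l.+1 (update R r (M (R a))) M
  | Write a r => Config l.+1 R (update M (R a) (R r))
  | JumpZero r l' => Config (if R r == 0 then l' else l.+1) R M
  | Halt => c
  end.

Definition input_config (w : seq nat) : config :=
  Config 0 (fun _ => 0) (nth 0 w).

Definition run (prog : program) (w : seq nat) (t : nat) : config :=
  iter t (step prog) (input_config w).

Definition words_bounded (b : nat) (c : config) : Prop :=
  forall i, reg c i <= b /\ mem c i <= b.

(* On input [w], [prog] halts within [time] steps with [out] in register 0,
   and no word exceeds [b] on the way. *)
Definition computes (prog : program) (time b : nat) (w : seq nat) (out : nat) :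
    Prop :=
  exists t, [/\ t <= time, current prog (run prog w t) = Halt,
    reg (run prog w t) 0 = out &
    forall i, i <= t -> words_bounded b (run prog w i)].

(* The vertices are numbered from 0 in an arbitrary way [num]; the exits and
   the edges are listed in an arbitrary order, once each, and the two ends of
   an edge are given in an arbitrary order. *)
Definition encodes (I : instance) (w : seq nat) : Prop :=
  exists (num : vertex (board I) -> nat) (xs : seq (vertex (board I)))
         (es : seq (vertex (board I) * vertex (board I))),
  [/\ injective num,
      forall v, num v < #|vertex (board I)|,
      perm_eq xs (enum (exits I)),
      perm_eq [seq [set uv.1; uv.2] | uv <- es] (enum (edges (board I))) &
      w = [:: #|vertex (board I)|; size es; size xs; num (start I)]
          ++ [seq num x | x <- xs]
          ++ flatten [seq [:: num uv.1; num uv.2] | uv <- es]].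

Definition player_code (P : player) : nat :=
  match P with Trapper => 1 | Storm => 0 end.

(* Main.v *)
(* Let W be the least set of vertices that contains the exits and every vertex
   with at least two neighbours in W.  If the trapper has just moved to a
   vertex of W, the Storm can cut only one of the two edges to vertices that
   entered W earlier, and the edges between such vertices are still intact, so
   the trapper descends through W to an exit.  Outside W every vertex has at
   most one edge into W, and the Storm keeps the trapper out by always cutting
   it.  As the trapper moves first, he wins iff he starts at an exit or next to
   a vertex of W.  Breadth-first search with a counter per vertex computes W in
   linear time, and the queue lists W in an order witnessing its closure. *)

Require Import Defs.
From mathcomp Require Import all_boot zify.
Set Implicit Arguments.
Unset Strict Implicit.
Unset Printing Implicit Defensive.

(** * Termination of plays, and why at most one player can win *)

Section Blizzard.
Variable I : instance.
Local Notation V := (vertex (board I)).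
Local Notation Ed := (edges (board I)).

Lemma edge_neq (u v : V) : [set u; v] \in Ed -> u != v.
Proof. by move=> /edges_card2; rewrite cards2; case: eqP. Qed.

Lemma not_won_both (p : position I) : won Trapper p -> won Storm p -> False.
Proof.
move=> /= px /forall_inP /(_ _ px) /negP; apply.
exact: connect0.
Qed.

Lemma play_present P f h (p : position I) :
  play P f h p -> present p \subset Ed.
Proof.
elim=> [|{}h {}p q _ sub _]; first exact: subxx.
rewrite /move; case: (turn p) => [[v _ ->]|[e [_ _ ->]]] //= _.
exact: subset_trans (subsetDl _ _) sub.
Qed.

(** Weight 2 on an edge lets its deletion outweigh handing the turn back to the trapper. *)
Definition measure (p : position I) : nat :=
  #|present p|.*2 + (if turn p is Trapper then 1 else 0).

Lemma move_measure (p q : position I) : move p q -> measure q < measure p.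
Proof.
rewrite /move /measure; case: (turn p) => [[v _ ->]|[e [pe _ ->]]] /=; first lia.
by have := cardsD1 e (present p); rewrite pe /=; lia.
Qed.

(* Playing the two strategies against each other yields a play won by both. *)
Lemma winning_strategy_excl :
  has_winning_strategy I Trapper -> has_winning_strategy I Storm -> False.
Proof.
move=> [f [fm fw]] [g [gm gw]].
suff H d h p : measure p < d -> play Trapper f h p -> play Storm g h p -> False.
  exact: (H _ _ _ (ltnSn _) (play_initial _ _) (play_initial _ _)).
elim: d h p => // d IHd h p ltpd pf pg.
have [ov|nov] := boolP (Defs.over p).
  exact: not_won_both (fw _ _ pf ov) (gw _ _ pg ov).
have next q : move p q -> (turn p = Trapper -> q = f h p) ->
    (turn p = Storm -> q = g h p) -> False.
  move=> mq qf qg; apply: (IHd (rcons h p) q).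
  - by move: (move_measure mq); lia.
  - exact: play_move.
  - exact: play_move.
case E: (turn p).
- by apply: (next (f h p)); rewrite ?E //; apply: fm.
- by apply: (next (g h p)); rewrite ?E //; apply: gm.
Qed.

(** * Winning strategies read off a ranked set [W] *)

Section Closure.
Variables (W : {set V}) (r : V -> nat).
Hypothesis rank_pair : forall v, v \in W -> v \notin exits I ->
  exists u1 u2, [/\ u1 != u2,
    [&& u1 \in W, r u1 < r v & [set v; u1] \in Ed] &
    [&& u2 \in W, r u2 < r v & [set v; u2] \in Ed]].

(** The trapper's invariant. It ignores edges reaching above the rank of [v], which the Storm may
    have cut during the descent. *)
Definition intact (v : V) (E : {set {set V}}) : bool :=
  [forall a in W, forall b in W,
    [&& r a <= r v, r b <= r v & [set a; b] \in Ed] ==> ([set a; b] \in E)].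

Lemma intactP v (E : {set {set V}}) :
  reflect (forall a b, a \in W -> b \in W -> r a <= r v -> r b <= r v ->
             [set a; b] \in Ed -> [set a; b] \in E) (intact v E).
Proof.
apply: (iffP forall_inP) => H a.
  move=> b aW bW av bv ab; move/forall_inP: (H a aW) => /(_ b bW).
  by rewrite av bv ab.
move=> aW; apply/forall_inP => b bW; apply/implyP => /and3P[]; exact: H.
Qed.

Definition trapper_strategy : strategy I := fun _ p =>
  if [pick v | [&& v \in W, [set place p; v] \in present p &
                 intact v (present p)]] is Some v
  then Position Storm v (present p) else p.

(** Play also stops once no exit is reachable; descending in rank along intact edges shows that this
    has not happened to a safe trapper. *)
Lemma intact_reachable (v : V) (E : {set {set V}}) (P : player) :
  v \in W -> intact v E ->
  exists2 x, x \in exits I & reachable (Position P v E) x.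
Proof.
move: {2}(r v).+1 (ltnSn (r v)) => d; elim: d v => // d IHd v ltvd vW iv.
have [xv|xv] := boolP (v \in exits I); first by exists v; rewrite // /reachable.
have [u [_ [_ /and3P[uW ltuv vu] _]]] := rank_pair vW xv.
have iu : intact u E.
  apply/intactP => a b aW bW ua ub; apply: (intactP _ _ iv) => //; lia.
have [x xx ux] : exists2 x, x \in exits I & reachable (Position P u E) x.
  by apply: IHd => //; lia.
exists x => //; apply: connect_trans ux; apply: connect1 => /=.
by apply: (intactP _ _ iv) => //; lia.
Qed.

Definition trapper_safe (p : position I) : Prop :=
  place p \in exits I \/
  match turn p with
  | Trapper => exists v, [/\ v \in W, [set place p; v] \in present p &
                             intact v (present p)]
  | Storm => place p \in W /\ intact (place p) (present p)
  end.

Lemma trapper_safe_over (p : position I) :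
  trapper_safe p -> Defs.over p -> won Trapper p.
Proof.
move=> sp /orP[//|] wp; case: sp => [//|sp]; exfalso.
suff [x xx px] : exists2 x, x \in exits I & reachable p x.
  by move/forall_inP: wp => /(_ x xx); rewrite px.
case: p {wp} sp => [[]] a E /=.
  move=> [v [vW av iv]].
  have [x xx vx] := intact_reachable Trapper vW iv.
  by exists x => //; apply: connect_trans vx; apply: connect1.
by move=> [aW ia]; apply: intact_reachable.
Qed.

Lemma trapper_wins :
  (start I \in exits I) || [exists u in W, [set start I; u] \in Ed] ->
  has_winning_strategy I Trapper.
Proof.
move=> win; exists trapper_strategy.
have stratE h p : turn p = Trapper -> trapper_safe p -> ~~ Defs.over p ->
    let q := trapper_strategy h p in move p q /\ trapper_safe q.
  move=> tp sp /norP[/negP nx _].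
  have {sp} sp : exists v, [/\ v \in W, [set place p; v] \in present p &
                           intact v (present p)].
    by case: sp; rewrite // tp.
  rewrite /trapper_strategy; case: pickP => [v /and3P[vW pv iv]|no].
    by split; [rewrite /move tp; exists v | right].
  by have [v [vW pv iv]] := sp; move: (no v); rewrite vW pv iv.
have safe h p : play Trapper trapper_strategy h p -> trapper_safe p.
  elim=> [|{}h {}p q _ sp nov mv qE].
    case/orP: win => [xs|/exists_inP[u uW su]]; [by left | right => /=].
    by exists u; split=> //; apply/intactP.
  case tp: (turn p).
    by rewrite qE //; apply: (stratE h p tp sp nov).2.
  case: sp => [xp|]; first by rewrite /Defs.over /= xp in nov.
  rewrite tp => -[pW ip].
  move: mv; rewrite /move tp => -[e [pe ine ->]]; right => /=.
  have xp : place p \notin exits I by case/norP: nov.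
  have [u1 [u2 [ne /and3P[u1W lt1 e1] /and3P[u2W lt2 e2]]]] := rank_pair pW xp.
  have keep u : u \in W -> r u < r (place p) -> intact u (present p :\ e).
    move=> uW ltu; apply/intactP => a b aW bW au bu ab.
    have abp : [set a; b] \in present p.
      by apply: (intactP _ _ ip) => //; apply: leq_trans (ltnW ltu).
    (* The deleted edge [e] contains [place p], whose rank exceeds those of [a] and [b]. *)
    rewrite in_setD1 abp andbT; apply: contraTneq ine => <-.
    rewrite in_set2 negb_or; apply/andP; split; apply/eqP => Ep.
      by rewrite Ep ltnNge au in ltu.
    by rewrite Ep ltnNge bu in ltu.
  have pres u : u \in W -> r u < r (place p) -> [set place p; u] \in Ed ->
      [set place p; u] \in present p.
    by move=> uW ltu pu; apply: (intactP _ _ ip) => //; apply: ltnW.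
  (* A single cut spares at least one of the two edges leading down from [place p]. *)
  have [eE|ne1] := eqVneq [set place p; u1] e; last first.
    by exists u1; split; rewrite ?keep // !inE ne1 pres.
  exists u2; split; rewrite ?keep // !inE pres // andbT -eE.
  apply/eqP => /setP /(_ u2); rewrite !inE eqxx orbT (negPf (_ : u2 != u1)) //.
    by move/esym; rewrite orbF => /eqP E2; rewrite E2 ltnn in lt2.
  by rewrite eq_sym.
split=> h p pl; first by move=> nov tp; exact: (stratE h p tp (safe _ _ pl) nov).1.
by apply: trapper_safe_over; apply: safe pl.
Qed.

Hypothesis exitsW : exits I \subset W.
Hypothesis closedW : forall v u1 u2, v \notin W -> u1 \in W -> u2 \in W ->
  [set v; u1] \in Ed -> [set v; u2] \in Ed -> u1 = u2.

(** The Storm has to delete an edge in every round, so when no edge leads into [W] an arbitrary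
    incident edge is cut. *)
Definition storm_strategy : strategy I := fun _ p =>
  if [pick u in W | [set place p; u] \in present p] is Some u
  then Position Trapper (place p) (present p :\ [set place p; u])
  else if [pick u | [set place p; u] \in present p] is Some u
  then Position Trapper (place p) (present p :\ [set place p; u]) else p.

Definition storm_safe (p : position I) : Prop :=
  match turn p with
  | Trapper => (place p \notin exits I) /\
      forall u, u \in W -> [set place p; u] \notin present p
  | Storm => place p \notin W
  end.

Lemma storm_wins :
  ~~ ((start I \in exits I) || [exists u in W, [set start I; u] \in Ed]) ->
  has_winning_strategy I Storm.
Proof.
case/norP=> nxs nadj; exists storm_strategy.
have outside p : storm_safe p -> place p \notin exits I.
  rewrite /storm_safe; case: (turn p) => [[]//|].
  by apply: contra; apply: (subsetP exitsW).
have stratE h p : turn p = Storm -> present p \subset Ed -> storm_safe p ->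
    ~~ Defs.over p -> let q := storm_strategy h p in move p q /\ storm_safe q.
  move=> tp sub sp nov; have xp := outside p sp.
  move: sp; rewrite /storm_safe tp => pW.
  rewrite /storm_strategy; case: pickP => [u /andP[uW pu]|no].
    split; first by rewrite /move tp; exists [set place p; u]; rewrite !inE eqxx.
    (* By [closedW] the edge just cut was the only one from [place p] into [W]. *)
    split=> //= u' u'W; apply/negP; rewrite !inE => /andP[/negP ne pu']; apply: ne.
    by apply/eqP; rewrite (closedW pW u'W uW) ?(subsetP sub).
  case: pickP => [u pu|no'].
    split; first by rewrite /move tp; exists [set place p; u]; rewrite !inE eqxx.
    split=> //= u' u'W; apply/negP; rewrite !inE => /andP[_ pu'].
    by move: (no u'); rewrite /= u'W pu'.
  (* With no edge left at [place p], which is not an exit, the Storm would already have won. *)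
  exfalso; move: nov; rewrite /Defs.over negb_or => /andP[_ /negP[]].
  apply/forall_inP => x xx; apply/negP => /connectP[[|y s] /= pth Ex].
    by rewrite -Ex xx in xp.
  by case/andP: pth => py _; move: (no' y); rewrite py.
have safe h p : play Storm storm_strategy h p -> storm_safe p.
  elim=> [|{}h {}p q pl sp nov mv qE].
    split=> // u uW; apply: contra nadj => su; apply/exists_inP; by exists u.
  case tp: (turn p); last first.
    by rewrite qE //; apply: (stratE h p tp (play_present pl) sp nov).2.
  move: mv sp; rewrite /move /storm_safe tp => -[v pv ->] [_ no] /=.
  by apply/negP => vW; move: (no v vW); rewrite pv.
split=> h p pl.
  move=> nov tp; exact: (stratE h p tp (play_present pl) (safe _ _ pl) nov).1.
case/orP=> // xp.
by have /negP := outside p (safe _ _ pl).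
Qed.

End Closure.

End Blizzard.

(** * A structured language over the RAM and a program logic that counts steps *)

#[local] Arguments update f i k j /.

Local Notation rOut := 0.
Local Notation rZero := 1.

Inductive command :=
| Block of seq instruction
| Seq of command & command
| While of nat & command.

(* [rZero] is never written, so that [JumpZero rZero] is an unconditional
   jump. *)
Fixpoint compile (l : nat) (c : command) : seq instruction :=
  match c with
  | Block ss => ss
  | Seq c1 c2 => let p1 := compile l c1 in p1 ++ compile (l + size p1) c2
  | While r c => let p := compile l.+1 c in
      JumpZero r (l + (size p).+2) :: rcons p (JumpZero rZero l)
  end.

Section Hoare.
Variable b : nat.
Implicit Types (R M : nat -> nat) (prog : program).

Definition goes prog (t : nat) (c c' : config) : Prop :=
  iter t (step prog) c = c' /\
  forall i, i <= t -> words_bounded b (iter i (step prog) c).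

Lemma goes0 prog c : words_bounded b c -> goes prog 0 c c.
Proof. by move=> bc; split=> // i; rewrite leqn0 => /eqP ->. Qed.

Lemma goes_trans prog t1 t2 c1 c2 c3 :
  goes prog t1 c1 c2 -> goes prog t2 c2 c3 -> goes prog (t1 + t2) c1 c3.
Proof.
move=> [E12 b12] [E23 b23]; split; first by rewrite addnC iterD E12.
move=> i le_i; have [/b12//|lt_i] := leqP i t1.
by rewrite -(subnK (ltnW lt_i)) iterD E12; apply: b23; lia.
Qed.

Lemma goes1 prog c c' :
  words_bounded b c -> step prog c = c' -> words_bounded b c' -> goes prog 1 c c'.
Proof.
by move=> bc E bc'; split=> // -[|[|i]] //= _; rewrite E.
Qed.

Definition placed prog (l : nat) (ss : seq instruction) : Prop :=
  exists pre post, prog = pre ++ ss ++ post /\ size pre = l.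

Lemma placed_cat prog l ss1 ss2 : placed prog l (ss1 ++ ss2) ->
  placed prog l ss1 /\ placed prog (l + size ss1) ss2.
Proof.
move=> [pre [post [-> <-]]]; split; first by exists pre, (ss2 ++ post); rewrite !catA.
by exists (pre ++ ss1), post; rewrite size_cat !catA.
Qed.

Lemma placed_nth prog l i ss : placed prog l (i :: ss) -> nth Halt prog l = i.
Proof. by move=> [pre [post [-> <-]]]; rewrite nth_cat ltnn subnn. Qed.

(* The number passed to the postcondition is the part of the time budget that
   has not been spent. *)
Definition wp (c : command) (Q : nat -> (nat -> nat) -> (nat -> nat) -> Prop)
    (k : nat) R M : Prop :=
  R rZero = 0 -> (forall l, words_bounded b (Config l R M)) ->
  forall prog l, placed prog l (compile l c) ->
  exists t R' M', [/\ t <= k,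
    goes prog t (Config l R M) (Config (l + size (compile l c)) R' M'),
    R' rZero = 0 & Q (k - t) R' M'].

Lemma goes_bounded prog t c l R M : goes prog t c (Config l R M) ->
  forall l', words_bounded b (Config l' R M).
Proof. by move=> [E /(_ t (leqnn t))]; rewrite E. Qed.

Lemma wp_mono c (Q Q' : nat -> (nat -> nat) -> (nat -> nat) -> Prop) k R M :
  (forall k' R' M', Q k' R' M' -> Q' k' R' M') -> wp c Q k R M -> wp c Q' k R M.
Proof.
move=> QQ' w R0 bR prog l pl.
have [t [R' [M' [le_t g R'0 q]]]] := w R0 bR prog l pl.
by exists t, R', M'; split=> //; apply: QQ'.
Qed.

Lemma wp_seq c1 c2 Q k R M : wp c1 (wp c2 Q) k R M -> wp (Seq c1 c2) Q k R M.
Proof.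
move=> w1 R0 bR prog l /= /placed_cat[p1 p2].
have [t1 [R1 [M1 [le1 g1 R10]]]] := w1 R0 bR prog l p1.
move=> /(_ R10 (goes_bounded g1) prog _ p2)[t2 [R2 [M2 [le2 g2 R20 q2]]]].
exists (t1 + t2), R2, M2; split=> //; first lia.
  by rewrite size_cat addnA; apply: goes_trans g2.
by rewrite subnDA.
Qed.

(** Termination needs no separate variant: the test and the jump back each spend a unit, so the
    budget itself decreases. *)
Lemma wp_while (Inv Q : nat -> (nat -> nat) -> (nat -> nat) -> Prop) r c :
  (forall k R M, Inv k R M -> 0 < k /\
    if R r == 0 then Q k.-1 R M
    else wp c (fun k' R' M' => 0 < k' /\ Inv k'.-1 R' M') k.-1 R M) ->
  forall k R M, Inv k R M -> wp (While r c) Q k R M.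
Proof.
move=> H k; elim/ltn_ind: k => k IHk R M inv R0 bR prog l pl.
have [k0] := H k R M inv; have jump := placed_nth pl; case: eqP => [Rr q|/eqP Rr].
  exists 1, R, M; split=> //; last by rewrite subn1.
  apply: goes1 => //; rewrite /step /current /= jump Rr eqxx /=.
  by congr Config; rewrite size_rcons.
move=> /= wc.
have [pc pj] : placed prog l.+1 (compile l.+1 c) /\
    placed prog (l.+1 + size (compile l.+1 c)) [:: JumpZero rZero l].
  apply: placed_cat; move: pl => /=; rewrite -cat1s -cats1 => /placed_cat[_].
  by rewrite addn1.
have g0 : goes prog 1 (Config l R M) (Config l.+1 R M).
  by apply: goes1 => //; rewrite /step /current /= jump (negPf Rr).
have [t [R1 [M1 [le1 g1 R10 [gt0 inv1]]]]] := wc R0 bR prog _ pc.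
have g2 : goes prog 1 (Config (l.+1 + size (compile l.+1 c)) R1 M1) (Config l R1 M1).
  have bd := goes_bounded g1; apply: goes1 => //.
  by have back := placed_nth pj; rewrite /step /current /= back R10.
have ltk : (k.-1 - t).-1 < k by lia.
have [t' [R2 [M2 [le2 g3 R20 q2]]]] :=
  IHk _ ltk R1 M1 inv1 R10 (goes_bounded g1) prog l pl.
exists (1 + t + 1 + t'), R2, M2; split=> //; first lia.
  by do 3?[apply: goes_trans; last eassumption].
by rewrite (_ : k - _ = (k.-1 - t).-1 - t') //; lia.
Qed.

(* The alias keeps simplification from unfolding writes to the memory. *)
Definition store : (nat -> nat) -> nat -> nat -> nat -> nat := update.

(** Only [Const] and [Add] come with a bound to check, since the other instructions create no word
    larger than those already present. *)
Fixpoint block_wp (ss : seq instruction) (Q : (nat -> nat) -> (nat -> nat) -> Prop)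
    R M : Prop :=
  match ss with
  | [::] => Q R M
  | i :: ss =>
    match i with
    | Const r x => [/\ r != rZero, x <= b & block_wp ss Q (update R r x) M]
    | Add r u v =>
      [/\ r != rZero, R u + R v <= b & block_wp ss Q (update R r (R u + R v)) M]
    | Defs.Sub r u v => r != rZero /\ block_wp ss Q (update R r (R u - R v)) M
    | Read r u => r != rZero /\ block_wp ss Q (update R r (M (R u))) M
    | Write u r => block_wp ss Q R (store M (R u) (R r))
    | _ => False
    end
  end.

Lemma update_bounded (f : nat -> nat) i x :
  (forall j, f j <= b) -> x <= b -> forall j, update f i x j <= b.
Proof. by move=> bf bx j /=; case: eqP. Qed.

Lemma update_zero R r x : r != rZero -> update R r x rZero = R rZero.
Proof. by rewrite /= eq_sym => /negPf ->. Qed.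

Lemma block_wp_goes ss (Q : (nat -> nat) -> (nat -> nat) -> Prop) R M prog l :
  R rZero = 0 -> (forall l, words_bounded b (Config l R M)) -> placed prog l ss ->
  block_wp ss Q R M ->
  exists R' M', [/\ goes prog (size ss) (Config l R M) (Config (l + size ss) R' M'),
    R' rZero = 0 & Q R' M'].
Proof.
elim: ss l R M => [|i ss IHis] l R M R0 bR pl.
  by move=> q; exists R, M; rewrite addn0; split=> //; apply: goes0.
have bR1 j : R j <= b by case: (bR 0 j).
have bM1 j : M j <= b by case: (bR 0 j).
have pl' : placed prog l.+1 ss.
  by move: pl; rewrite -cat1s => /placed_cat[_]; rewrite addn1.
have next R1 M1 : R1 rZero = 0 -> (forall j, R1 j <= b) -> (forall j, M1 j <= b) ->
    step prog (Config l R M) = Config l.+1 R1 M1 -> block_wp ss Q R1 M1 ->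
    exists R' M', [/\ goes prog (size ss).+1 (Config l R M)
      (Config (l + (size ss).+1) R' M'), R' rZero = 0 & Q R' M'].
  move=> R10 bR' bM' st.
  have b1 l' : words_bounded b (Config l' R1 M1) by move=> j; split=> /=.
  case/(IHis l.+1 R1 M1 R10 b1 pl') => R' [M' [g R'0 q]]; exists R', M'.
  by split=> //; rewrite addnS -addSn; apply: (goes_trans (goes1 _ st _) g).
move: (placed_nth pl) next; rewrite /step /current.
case: i {pl} => [r x|r u v|r u v|r u|u r|r u|] /= -> // next.
- case=> nz bx; apply: next => //; first by rewrite update_zero.
  exact: update_bounded.
- case=> nz bx; apply: next => //; first by rewrite update_zero.
  exact: update_bounded.
- case=> nz; apply: next => //; first by rewrite update_zero.
  by apply: update_bounded => //; apply: leq_trans (bR1 u); apply: leq_subr.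
- case=> nz; apply: next => //; first by rewrite update_zero.
  exact: update_bounded.
- by apply: next => //; apply: update_bounded.
Qed.

Lemma wp_block ss Q k R M : size ss <= k ->
  block_wp ss (Q (k - size ss)) R M -> wp (Block ss) Q k R M.
Proof.
move=> lek w R0 bR prog l pl.
have [R' [M' [g R'0 q]]] := block_wp_goes R0 bR pl w.
by exists (size ss), R', M'.
Qed.

Lemma wp_computes c (P : nat -> Prop) k w : all (leq^~ b) w ->
  wp c (fun _ R _ => P (R rOut)) k (fun _ => 0) (nth 0 w) ->
  exists2 out, P out & computes (compile 0 c) k b w out.
Proof.
move=> /allP bw wc.
have bI l : words_bounded b (Config l (fun _ => 0) (nth 0 w)).
  move=> i; split=> //=; have [lti|?] := ltnP i (size w); last by rewrite nth_default.
  exact/bw/mem_nth.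
have pl : placed (compile 0 c) 0 (compile 0 c).
  by exists [::], [::]; rewrite cats0.
have [t [R [M [le_t [st bt] _ q]]]] := wc erefl bI _ _ pl.
exists (R rOut) => //; exists t; rewrite /run /input_config.
split=> //; last by rewrite st.
(* Past the last instruction, [nth] yields its default [Halt]. *)
by rewrite st /current /= add0n nth_default.
Qed.

End Hoare.

(** * The linear-time program *)

Local Notation rOne := 2.
Local Notation rStart := 3.
Local Notation rShift := 4.
Local Notation rEnd := 5.
Local Notation rCnt := 6.
Local Notation rTail := 7.
Local Notation rHead := 8.
Local Notation rPtr := 9.
Local Notation rFlag := 10.
Local Notation rV := 11.
Local Notation rU := 12.
Local Notation rAddr := 13.
Local Notation rTmp := 14.
Local Notation rEdges := 15.

(* Memory layout, for [n] vertices, [m] edges and an input of length [F]: the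
   list heads at [F + v], the counters at [F + n + v], the link of the half-edge
   stored at [p] at [p + D] with [D = 2 * n + 2 * m], and the queue from [F + D]
   on.  The half-edge at [p] lies in the list of the other end of its edge. *)
Definition setup := Block
  [:: Const rOne 1;
      Read rShift rZero;
      Read rV rOne;
      Add rAddr rOne rOne; Read rEnd rAddr;
      Add rAddr rAddr rOne; Read rStart rAddr;
      Add rPtr rAddr rOne;
      Add rEdges rPtr rEnd;
      Add rV rV rV;
      Add rEnd rEdges rV;
      Add rCnt rEnd rShift;
      Add rShift rShift rShift; Add rShift rShift rV;
      Add rHead rEnd rShift; Add rTail rHead rZero;
      Defs.Sub rFlag rEdges rPtr].

(** The counter of an exit starts at 2, as if two neighbours in [W] had been seen; one threshold
    then serves all vertices, and no exit is queued again. *)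
Definition enqueue_exits := While rFlag (Block
  [:: Read rU rPtr;
      Add rAddr rCnt rU; Add rTmp rOne rOne; Write rAddr rTmp;
      Write rTail rU; Add rTail rTail rOne;
      Add rPtr rPtr rOne; Defs.Sub rFlag rEdges rPtr]).

Definition link_edges := While rFlag (Block
  [:: Read rV rPtr; Add rTmp rPtr rOne; Read rU rTmp;
      Add rAddr rEnd rU; Read rTmp rAddr; Write rAddr rPtr;
      Add rAddr rPtr rShift; Write rAddr rTmp; Add rPtr rPtr rOne;
      Add rAddr rEnd rV; Read rTmp rAddr; Write rAddr rPtr;
      Add rAddr rPtr rShift; Write rAddr rTmp; Add rPtr rPtr rOne;
      Defs.Sub rFlag rEnd rPtr]).

(* The subtractions turn the old counter [c] into [c - (c - 1) - (c - 1)], that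
   is [c == 1], so that the vertex just written at the end of the queue is kept
   only when its counter reaches 2. *)
Definition scan_list := While rPtr (Block
  [:: Read rU rPtr; Add rAddr rCnt rU; Read rTmp rAddr;
      Add rV rTmp rOne; Write rAddr rV;
      Write rTail rU;
      Defs.Sub rV rTmp rOne; Defs.Sub rTmp rTmp rV; Defs.Sub rTmp rTmp rV;
      Add rTail rTail rTmp;
      Add rAddr rPtr rShift; Read rPtr rAddr]).

Definition scan_queue := While rFlag
  (Seq (Block [:: Read rV rHead; Add rHead rHead rOne;
                  Add rAddr rEnd rV; Read rPtr rAddr])
  (Seq scan_list
       (Block [:: Defs.Sub rFlag rTail rHead]))).

(** By truncation, 1 - (1 - c) is the truth value of 0 < c. The counter of the start is positive iff
    it is an exit or has a neighbour in [W]. *)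
Definition answer := Block
  [:: Add rAddr rCnt rStart; Read rTmp rAddr;
      Defs.Sub rTmp rOne rTmp; Defs.Sub rOut rOne rTmp].

Definition blizzard :=
  Seq setup
  (Seq enqueue_exits
  (Seq (Block [:: Defs.Sub rFlag rEnd rPtr])
  (Seq link_edges
  (Seq (Block [:: Defs.Sub rFlag rTail rHead])
  (Seq scan_queue answer))))).

(** 0 can serve as the null pointer because half-edges lie at addresses at least 4. *)
Fixpoint chain (nx : nat -> nat) (q : nat) (l : seq nat) : Prop :=
  if l is p :: l' then q = p /\ chain nx (nx p) l' else q = 0.

Lemma chain_update nx p y q l :
  p \notin l -> chain nx q l -> chain (update nx p y) q l.
Proof.
elim: l q => //= p' l IHl q; rewrite inE negb_or eq_sym => /andP[/negPf -> pl] [-> ?].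
by split=> //; apply: IHl.
Qed.

Lemma chain_cons (hd nx : nat -> nat) (L : nat -> seq nat) p a :
  (forall v, chain nx (hd v) (L v)) -> (forall v, p \notin L v) ->
  forall v, chain (update nx p (hd a)) (update hd a p v) (nseq (a == v) p ++ L v).
Proof.
move=> cL pL v; have cv u := chain_update (hd a) (pL u) (cL u).
rewrite /= [v == a]eq_sym; case: eqP => [<-|_] //=; rewrite eqxx.
by split.
Qed.

Lemma uniq_lt_size n (l : seq nat) :
  uniq l -> (forall v, v \in l -> v < n) -> size l <= n.
Proof.
move=> ul ltl; rewrite -(size_iota 0 n); apply: uniq_leq_size => // v /ltl.
by rewrite mem_iota.
Qed.

(** * Correctness and running time of the search *)

Section Search.
Variables (b n s : nat) (xs : seq nat) (es : seq (nat * nat)).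
Local Notation m := (size es).
Local Notation E := (4 + size xs).
Local Notation F := (4 + size xs + 2 * m).
Local Notation D := (2 * n + 2 * m).

Definition input : seq nat :=
  [:: n; m; size xs; s] ++ xs ++ flatten [seq [:: e.1; e.2] | e <- es].

(** The initial memory; at the address of a half-edge it holds the vertex to which that half-edge
    leads. *)
Definition target : nat -> nat := nth 0 input.

(* The addresses in the list of [v] once the first [i] edges are linked. *)
Fixpoint adj (i v : nat) : seq nat :=
  if i is j.+1 then
    let e := nth (0, 0) es j in
    nseq (e.1 == v) (E + 2 * j).+1 ++ (nseq (e.2 == v) (E + 2 * j) ++ adj j v)
  else [::].

(** Phrased through the linked lists, as the program computes it; [reached_num] identifies it with a
    number of neighbours in the graph. *)
Definition reached (vs : seq nat) (u : nat) : nat :=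
  \sum_(v <- vs) count_mem u [seq target p | p <- adj m v].

Lemma size_input : size input = F.
Proof.
rewrite !size_cat /= addnA; congr (_ + _); rewrite mul2n.
by elim: es => //= e l ->.
Qed.

Lemma target_exit i : i < size xs -> target (4 + i) = nth 0 xs i.
Proof. by move=> lti; rewrite /target /input /= nth_cat lti. Qed.

Lemma target_edge i : i < m ->
  target (E + 2 * i) = (nth (0, 0) es i).1 /\
  target (E + 2 * i).+1 = (nth (0, 0) es i).2.
Proof.
have shift j : target (E + j) =
    nth 0 (flatten [seq [:: e.1; e.2] | e <- es]) j.
  by rewrite /target /input -addnA /= nth_cat ltnNge leq_addr /= add0n addKn.
rewrite -addnS !shift mul2n; elim: es i {shift} => //= e l IHl [|i] //.
by rewrite ltnS doubleS /= => /IHl.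
Qed.

Lemma adj_bound i v p : p \in adj i v -> E <= p < E + 2 * i.
Proof.
elim: i => //= i IHi; rewrite !mem_cat !mem_nseq => /orP[/andP[_ /eqP->]|]; first lia.
by move=> /orP[/andP[_ /eqP->]|/IHi]; lia.
Qed.

Lemma count_adj u v :
  count_mem u [seq target p | p <- adj m v] = count_mem (v, u) es + count_mem (u, v) es.
Proof.
(* Generalizing to prefixes of [es] makes both sides grow by one edge at a time. *)
rewrite -{2 3}[es]take_size; move: (leqnn m); move: {1 3 4 5}m => i.
elim: i => [|i IHi] lti.
  by rewrite take0.
have [t1 t2] := target_edge lti.
rewrite (take_nth (0, 0)) // -!cats1 !count_cat /= !map_cat !count_cat.
rewrite !map_nseq !count_nseq IHi ?(ltnW lti) // t1 t2; case: (nth _ _ _) => a c /=.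
rewrite !xpair_eqE; do 4 case: eqP => /= _; lia.
Qed.

(** Each edge gives two half-edges, and each of these lies in the list of a single vertex. This is
    what makes the search linear. *)
Lemma sum_size_adj i vs : uniq vs -> \sum_(v <- vs) size (adj i v) <= 2 * i.
Proof.
move=> uvs; elim: i => [|i IHi] /=; first by rewrite big1.
under eq_bigr do rewrite !size_cat !size_nseq.
rewrite !big_split /=.
have one a : \sum_(v <- vs) (a == v) <= 1.
  suff -> : \sum_(v <- vs) (a == v) = count_mem a vs by rewrite count_uniq_mem // leq_b1.
  by elim: vs {uvs IHi} => [|v l IHl]; rewrite ?big_nil // big_cons IHl /= eq_sym.
rewrite (_ : 2 * i.+1 = 1 + (1 + 2 * i)); last lia.
by rewrite !leq_add.
Qed.

Definition memory (M hd nx cnt : nat -> nat) (que : seq nat) : Prop :=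
  [/\ forall i, i < F -> M i = target i,
      forall v, v < n -> M (F + v) = hd v,
      forall v, v < n -> M (F + n + v) = cnt v,
      forall p, E <= p < F -> M (p + D) = nx p &
      forall i, i < size que -> M (F + D + i) = nth 0 que i].

Ltac frame := case=> ? ? ? ? ? *; split=> ? ?; rewrite /store /=;
  repeat case: eqP; intros; first [by auto | exfalso; lia].

Lemma memory_head M hd nx cnt que v y :
  memory M hd nx cnt que -> v < n ->
  memory (store M (F + v) y) (update hd v y) nx cnt que.
Proof. frame. Qed.

Lemma memory_count M hd nx cnt que v y :
  memory M hd nx cnt que -> v < n ->
  memory (store M (F + n + v) y) hd nx (update cnt v y) que.
Proof. frame. Qed.

Lemma memory_next M hd nx cnt que p y :
  memory M hd nx cnt que -> E <= p < F ->
  memory (store M (p + D) y) hd (update nx p y) cnt que.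
Proof. frame. Qed.

Lemma memory_push M hd nx cnt que u :
  memory M hd nx cnt que ->
  memory (store M (F + D + size que) u) hd nx cnt (rcons que u).
Proof.
case=> H1 H2 H3 H4 H5; split=> i Hi; rewrite /store /=; case: eqP => Ei.
1,3,5,7: by exfalso; lia.
1,2,3,4: by auto.
  by rewrite (_ : i = size que) ?nth_rcons ?ltnn ?eqxx //; lia.
move: Hi Ei; rewrite nth_rcons size_rcons => Hi Ei.
by case: ltngtP => ?; first exact: H5; lia.
Qed.

(** For the unconditional write in [scan_list]: a vertex that is not kept stays as an irrelevant
    word just past the queue. *)
Lemma memory_pop M hd nx cnt que u :
  memory M hd nx cnt (rcons que u) -> memory M hd nx cnt que.
Proof.
case=> H1 H2 H3 H4 H5; split=> // i lti; move: (H5 i).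
by rewrite size_rcons nth_rcons lti; apply; apply: ltnW.
Qed.

Lemma reached_cat vs1 vs2 u :
  reached (vs1 ++ vs2) u = reached vs1 u + reached vs2 u.
Proof. by rewrite /reached big_cat. Qed.

Lemma reached_le vs u : uniq vs -> reached vs u <= 2 * m.
Proof.
move=> uvs; apply: leq_trans (sum_size_adj m uvs).
by apply: leq_sum => v _; rewrite -(size_map target); apply: count_size.
Qed.

(* [l] is the part of the list of the vertex at position [h] of the queue that
   has already been scanned. *)
Record bfs (h : nat) (cnt : nat -> nat) (que l : seq nat) : Prop := Bfs {
  bfs_uniq : uniq que;
  bfs_lt : forall v, v \in que -> v < n;
  bfs_count : forall u, u < n -> cnt u =
    2 * (u \in xs) + reached (take h que) u + count_mem u [seq target p | p <- l];
  bfs_mem : forall u, u < n -> (u \in que) = (1 < cnt u);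
  bfs_rank : forall u, u \in que ->
    u \in xs \/ 1 < reached (take (index u que) que) u }.

Lemma bfs_size h cnt que l : bfs h cnt que l -> size que <= n.
Proof. by case=> uq lq _ _ _; apply: uniq_lt_size. Qed.

Hypothesis xs_lt : all (ltn^~ n) xs.
Hypothesis xs_uniq : uniq xs.
Hypothesis es_lt : all (fun e => (e.1 < n) && (e.2 < n)) es.
Hypothesis s_lt : s < n.
Hypothesis b_large : 8 * (n + m).+1 <= b.

Lemma size_xs : size xs <= n.
Proof. by apply: uniq_lt_size => // v /(allP xs_lt). Qed.

Lemma edge_lt i : i < m ->
  ((nth (0, 0) es i).1 < n) /\ ((nth (0, 0) es i).2 < n).
Proof. by move=> lti; apply/andP; apply: (allP es_lt); apply: mem_nth. Qed.

Lemma target_lt v p : p \in adj m v -> target p < n.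
Proof.
move=> /adj_bound Hp.
have lti : (p - E)./2 < m by lia.
have [t1 t2] := target_edge lti; have [l1 l2] := edge_lt lti.
have [Ep|Ep] : p = E + 2 * (p - E)./2 \/ p = (E + 2 * (p - E)./2).+1 by lia.
- by rewrite Ep t1.
- by rewrite Ep t2.
Qed.

(** A vertex joins the queue exactly when its counter passes from 1 to 2, which happens at most
    once. *)
Lemma bfs_step h cnt que l1 p l2 (u := target p) :
  h < size que -> adj m (nth 0 que h) = l1 ++ p :: l2 -> bfs h cnt que l1 ->
  bfs h (update cnt u (cnt u).+1) (if cnt u == 1 then rcons que u else que)
    (rcons l1 p).
Proof.
move=> lth El [uq lq cE mE rE].
have un : u < n by apply: (@target_lt (nth 0 que h)); rewrite El mem_cat inE eqxx orbT.
have cE' v : v < n -> update cnt u (cnt u).+1 v = 2 * (v \in xs) +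
    reached (take h que) v + count_mem v [seq target p | p <- rcons l1 p].
  move=> vn; rewrite map_rcons -cats1 count_cat /= -/u eq_sym.
  case: eqP => [<-|_]; first by rewrite cE //= addn1 addnS.
  by rewrite cE //= !addn0.
case: eqP => cu; last first.
  split=> // v vn /=; case: eqP => [->|_]; rewrite mE //; lia.
have uq' : u \notin que by rewrite mE // cu.
split.
- by rewrite rcons_uniq uq' uq.
- by move=> v; rewrite mem_rcons inE => /orP[/eqP->|/lq].
- by move=> v vn; rewrite cE' // -(cats1 que) takel_cat // ltnW.
- move=> v vn; rewrite mem_rcons inE mE //=; case: eqP => [->|_]; by rewrite ?cu.
move=> v; rewrite mem_rcons inE => /orP[/eqP->|vq].
  right; rewrite -cats1 index_cat (negPf uq') /= eqxx addn0 take_size_cat //.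
  (* The edges counted for [u] come from the first [h] entries or from entry [h], all of which
     precede [u] in the new queue. *)
  have -> : que = take h que ++ nth 0 que h :: drop h.+1 que.
    by rewrite -drop_nth // cat_take_drop.
  rewrite reached_cat; have := cE' u un; rewrite /= eqxx cu /reached big_cons El.
  rewrite map_rcons map_cat /= -cats1 !count_cat /=.
  by lia.
case: (rE v vq) => [|lt1]; [by left | right].
by rewrite -cats1 index_cat vq takel_cat // index_size.
Qed.

(** Keeps the counters within the word bound. *)
Lemma bfs_count_le h cnt que l1 l2 u : h < size que ->
  adj m (nth 0 que h) = l1 ++ l2 -> bfs h cnt que l1 -> u < n ->
  cnt u <= 2 * m + 2.
Proof.
move=> lth El [uq _ cE _ _] un; rewrite cE //.
have := reached_le u (take_uniq h.+1 uq); rewrite (take_nth 0) // -cats1 reached_cat.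
rewrite {2}/reached big_seq1 El map_cat count_cat; case: (u \in xs) => /=; lia.
Qed.

Lemma bfs_next h cnt que : h < size que ->
  bfs h cnt que (adj m (nth 0 que h)) -> bfs h.+1 cnt que [::].
Proof.
move=> lth [uq lq cE mE rE]; split=> // u un; rewrite cE // (take_nth 0) //.
by rewrite -cats1 reached_cat {3}/reached big_seq1 /= addn0 addnA.
Qed.

Definition static (R : nat -> nat) : Prop :=
  [/\ R rOne = 1, R rStart = s, R rShift = D, R rEnd = F & R rCnt = F + n].

(** The third clause says that the queue is closed; the fourth, that its order witnesses why each
    vertex had to enter. *)
Definition found (que : seq nat) : Prop :=
  [/\ uniq que, forall v, v \in que -> v < n,
      forall u, u < n -> (u \in que) = (1 < 2 * (u \in xs) + reached que u) &
      forall u, u \in que -> u \in xs \/ 1 < reached (take (index u que) que) u].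

Definition verdict (out : nat) : Prop :=
  exists2 que, found que & out = ((s \in xs) || (0 < reached que s)).
Ltac discharge := repeat match goal with
  | |- and3 _ _ _ => split; [done | try lia |]
  | |- _ /\ _ => split; [done |]
  end.

(** [K] is the budget for the rest of the program. A round costs 10, for 8 instructions, the test
    and the jump back, and the 1 pays for the last test. The 18 and 14 below arise in the same way
    from 16 and 12 instructions. *)
Definition exits_inv (K k : nat) (R M : nat -> nat) : Prop :=
  exists i cnt,
  [/\ i <= size xs /\ 10 * (size xs - i) + 1 + K <= k,
      static R /\ R rEdges = E,
      [/\ R rPtr = 4 + i, R rFlag = size xs - i, R rTail = F + D + i &
          R rHead = F + D],
      memory M (fun=> 0) (fun=> 0) cnt (take i xs) &
      forall u, u < n -> cnt u = 2 * (u \in take i xs)].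

(** The postcondition restates the invariant at [k.+1] because the failing test has already spent a
    unit. *)
Lemma wp_enqueue_exits K k R M : exits_inv K k R M ->
  wp b enqueue_exits
    (fun k R M => [/\ exits_inv K k.+1 R M, R rPtr = E & K <= k]) k R M.
Proof.
apply: wp_while => {k R M} k R M [i [cnt]].
case=> [[lei lek] [[R1 RS RD RF RC] RE] [RP RFl RT RH] mem cE]; split; first lia.
case: eqP => Fl; rewrite RFl in Fl.
  have Ei : i = size xs by lia.
  split; [|lia|lia]; exists i, cnt; split=> //; first lia.
have lti : i < size xs by lia.
have un : nth 0 xs i < n by apply: (allP xs_lt); apply: mem_nth.
have := size_xs => lexs.
apply: wp_block => /=; first lia.
have tE : M (4 + i) = nth 0 xs i by case: mem => -> //; [rewrite target_exit | lia].
rewrite RC RP RT RE R1 tE; discharge.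
split; first lia.
exists i.+1, (update cnt (nth 0 xs i) 2); split=> //; first lia.
- by split=> /=; lia.
- rewrite (take_nth 0) //; have := memory_push (nth 0 xs i) (memory_count 2 mem un).
  by rewrite size_takel.
move=> u un'; rewrite (take_nth 0) // mem_rcons inE /=.
by case: eqP => // _; rewrite cE.
Qed.

Definition edges_inv (K k : nat) (R M : nat -> nat) : Prop :=
  exists i hd nx cnt,
  [/\ i <= m /\ 18 * (m - i) + 1 + K <= k, static R,
      [/\ R rPtr = E + 2 * i, R rFlag = 2 * (m - i),
          R rTail = F + D + size xs & R rHead = F + D],
      memory M hd nx cnt xs /\ (forall v, chain nx (hd v) (adj i v)) &
      forall u, u < n -> cnt u = 2 * (u \in xs)].

(** Amortized cost: 14 for each half-edge not in the list of a dequeued vertex, and 8 for each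
    vertex still to come, which includes the failing test of the inner loop. *)
Definition queue_inv (K k : nat) (R M : nat -> nat) : Prop :=
  exists h hd nx cnt que,
  [/\ h <= size que /\ 8 * (n - h) +
        14 * (2 * m - \sum_(v <- take h que) size (adj m v)) + 1 + K <= k,
      static R,
      [/\ R rFlag = size que - h, R rTail = F + D + size que & R rHead = F + D + h],
      memory M hd nx cnt que /\ (forall v, chain nx (hd v) (adj m v)) &
      bfs h cnt que [::]].

Definition list_inv (h K k : nat) (R M : nat -> nat) : Prop :=
  exists hd nx cnt que l1 l2,
  [/\ h < size que /\ 14 * size l2 + 8 * (n - h.+1) +
        14 * (2 * m - \sum_(v <- take h.+1 que) size (adj m v)) + 1 + K <= k,
      static R,
      [/\ R rTail = F + D + size que, R rHead = F + D + h.+1 & chain nx (R rPtr) l2],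
      memory M hd nx cnt que /\ (forall v, chain nx (hd v) (adj m v)) &
      adj m (nth 0 que h) = l1 ++ l2 /\ bfs h cnt que l1].

Lemma wp_link_edges K k R M : edges_inv K k R M ->
  wp b link_edges (fun k R M => exists hd nx cnt,
    [/\ K <= k, static R, R rTail = F + D + size xs /\ R rHead = F + D,
        memory M hd nx cnt xs /\ (forall v, chain nx (hd v) (adj m v)) &
        forall u, u < n -> cnt u = 2 * (u \in xs)]) k R M.
Proof.
apply: wp_while => {k R M} k R M [i [hd [nx [cnt]]]].
case=> [[lei lek] st [RP RFl RT RH] [mem ch] cE]; split; first lia.
case: eqP => Fl; rewrite RFl in Fl.
  have Ei : i = m by lia.
  by exists hd, nx, cnt; split=> //; [lia | split=> // v; have := ch v; rewrite Ei].
have lti : i < m by lia.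
have lexs := size_xs.
have [a_lt b_lt] := edge_lt lti; have [tgt1 tgt2] := target_edge lti.
have [R1 RS RD RF RC] := st.
set p := E + 2 * i in RP tgt1 tgt2 *.
have p_in : E <= p < F by rewrite /p; lia.
have p1_in : E <= p.+1 < F by rewrite /p; lia.
have p_notin v : p \notin adj i v by apply/negP => /adj_bound; rewrite /p; lia.
have p1_notin v : p.+1 \notin nseq ((nth (0, 0) es i).2 == v) p ++ adj i v.
  rewrite mem_cat mem_nseq negb_or; apply/andP; split; first by lia.
  by apply/negP => /adj_bound; rewrite /p; lia.
apply: wp_block => /=; first lia.
have ME1 : M p = (nth (0, 0) es i).1 by case: mem => -> //; lia.
have ME2 : M (p + 1) = (nth (0, 0) es i).2 by rewrite addn1; case: mem => -> //; lia.
(* The two ends get the names [u] and [v], with [aE] and [bE] recording what they abbreviate. *)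
have aE : (nth (0, 0) es i).1 = (nth (0, 0) es i).1 by [].
move: {2}(nth (0, 0) es i).1 aE => u aE; rewrite aE in a_lt ME1.
have bE : (nth (0, 0) es i).2 = (nth (0, 0) es i).2 by [].
move: {2}(nth (0, 0) es i).2 bE => v bE; rewrite bE in b_lt ME2 p1_notin.
have mem1 := memory_head p mem b_lt.
have mem2 := memory_next (hd v) mem1 p_in.
have mem3 := memory_head p.+1 mem2 a_lt.
have mem4 := memory_next (update hd v p u) mem3 p1_in.
have ch4 := chain_cons u (chain_cons v ch p_notin) p1_notin.
have MH1 : M (F + v) = hd v by case: mem => _ ->.
(* The ends are not assumed distinct here, so the second list head is read from the updated [hd]. *)
have MH2 : store (store M (F + v) p) (p + D) (hd v) (F + u) = update hd v p u.
  by case: mem2 => _ ->.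
rewrite RP RD RF R1 ME1 ME2 MH1 MH2; discharge.
all: try (rewrite /p; lia).
split; first lia.
exists i.+1, (update (update hd v p) u p.+1),
  (update (update nx p (hd v)) p.+1 (update hd v p u)), cnt.
split=> //.
- lia.
- by split=> //=; rewrite /p; lia.
- by split=> [|w]; [rewrite addn1 | rewrite /= aE bE; apply: ch4].
Qed.

Lemma wp_scan_list h K k R M : list_inv h K k R M ->
  wp b scan_list (fun k R M => exists hd nx cnt que,
    [/\ h < size que /\ 8 * (n - h.+1) +
          14 * (2 * m - \sum_(v <- take h.+1 que) size (adj m v)) + K <= k,
        static R, R rTail = F + D + size que /\ R rHead = F + D + h.+1,
        memory M hd nx cnt que /\ (forall v, chain nx (hd v) (adj m v)) &
        bfs h.+1 cnt que [::]]) k R M.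
Proof.
apply: wp_while => {k R M} k R M [hd [nx [cnt [que [l1 [l2]]]]]].
case=> [[lth lek] st [RT RH chp] [mem ch] [El bf]]; split; first lia.
case: l2 => [|p l2] /= in chp El lek *.
  rewrite chp eqxx; exists hd, nx, cnt, que; split=> //; first by lia.
  by apply: bfs_next => //; rewrite El cats0.
case: chp => RP chp.
have p_adj : p \in adj m (nth 0 que h) by rewrite El mem_cat inE eqxx orbT.
have p_in := adj_bound p_adj; have u_lt := target_lt p_adj.
rewrite RP; case: eqP => [?|_]; first lia.
have lexs := size_xs; have le_que := bfs_size bf.
have [R1 RS RD RF RC] := st.
apply: wp_block => /=; first lia.
have MP : M p = target p by case: mem => -> //; lia.
have bf' := bfs_step lth El bf.
move: (target p) MP u_lt bf' => u MP u_lt bf'.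
have MC : M (F + n + u) = cnt u by case: mem => _ _ ->.
have cu := bfs_count_le lth El bf u_lt.
have mem1 := memory_push u (memory_count (cnt u).+1 mem u_lt).
have MN : store (store M (F + n + u) (cnt u + 1)) (F + D + size que) u (p + D) = nx p.
  by rewrite addn1; case: mem1 => _ _ _ ->.
rewrite RP RT RC RD R1 MP MC MN; discharge.
split; first lia.
set q' := if _ then _ else _ in bf'.
have [takeE sizeE nthE] : [/\ take h.+1 q' = take h.+1 que,
    size q' = size que + (cnt u == 1) & nth 0 q' h = nth 0 que h].
  rewrite /q'; case: eqP => _; last by rewrite addn0.
  by rewrite -cats1 takel_cat // size_cat nth_cat lth.
(* The write at the tail takes place in either case; if the tail does not advance, [memory_pop]
   forgets it. *)
have memQ : memory (store (store M (F + n + u) (cnt u + 1)) (F + D + size que) u)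
    hd nx (update cnt u (cnt u).+1) q'.
  by rewrite addn1 /q'; case: eqP => // _; apply: memory_pop mem1.
exists hd, nx, (update cnt u (cnt u).+1), q', (rcons l1 p), l2; split=> //.
- by rewrite takeE sizeE; split; lia.
- by split=> //=; rewrite sizeE; case: eqP => /=; lia.
- by rewrite nthE cat_rcons.
Qed.

Lemma wp_scan_queue K k R M : queue_inv K k R M ->
  wp b scan_queue (fun k R M => exists hd nx cnt que,
    [/\ K <= k, static R, memory M hd nx cnt que & bfs (size que) cnt que [::]]) k R M.
Proof.
apply: wp_while => {k R M} k R M [h [hd [nx [cnt [que]]]]].
case=> [[leh lek] st [RFl RT RH] [mem ch] bf]; split; first lia.
case: eqP => Fl; rewrite RFl in Fl.
  have Eh : h = size que by lia.
  by exists hd, nx, cnt, que; split=> //; [lia | rewrite -{1}Eh].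
have lth : h < size que by lia.
have [R1 RS RD RF RC] := st.
have lexs := size_xs; have le_que := bfs_size bf.
have v_lt : nth 0 que h < n by apply: (bfs_lt bf); apply: mem_nth.
have MQ : M (F + D + h) = nth 0 que h by case: mem => _ _ _ _ ->.
have MH : M (F + nth 0 que h) = hd (nth 0 que h) by case: mem => _ ->.
(* This bound keeps [2 * m] minus the sum from truncating, so that the budget for the list of entry
   [h] can be released. *)
have work := sum_size_adj m (take_uniq h.+1 (bfs_uniq bf)).
have workE : \sum_(v <- take h.+1 que) size (adj m v) =
    \sum_(v <- take h que) size (adj m v) + size (adj m (nth 0 que h)).
  by rewrite (take_nth 0) // -cats1 big_cat big_seq1.
apply/wp_seq/wp_block => /=; first lia.
rewrite RH RF R1 MQ MH; discharge.
(* The 3 units pay for the closing block, the jump back and the last test of the outer loop. *)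
apply: wp_seq; apply: wp_mono (@wp_scan_list h K.+3 _ _ _ _); last first.
  exists hd, nx, cnt, que, [::], (adj m (nth 0 que h)); split=> //=.
  - split=> //; move: workE work lek.
    by set x := \sum_(_ <- _) _; set y := \sum_(_ <- _) _; lia.
  - by split=> //; lia.
move=> k' R' M' [hd' [nx' [cnt' [que' [[lth' lek'] st' [RT' RH'] mem' bf']]]]].
apply: wp_block => /=; first lia.
rewrite RT' RH'; discharge; split; first lia.
exists h.+1, hd', nx', cnt', que'; split=> //; first by split=> //; lia.
by split=> //=; lia.
Qed.

Lemma wp_answer hd nx cnt que k R M : 4 <= k -> static R ->
  memory M hd nx cnt que -> bfs (size que) cnt que [::] ->
  wp b answer (fun _ R _ => verdict (R rOut)) k R M.
Proof.
move=> lek [R1 RS RD RF RC] mem [uq lq cE mE rE].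
have lexs := size_xs.
apply: wp_block => //=; rewrite R1 RS RC.
have -> : M (F + n + s) = cnt s by case: mem => _ _ ->.
discharge; have cE' u : u < n -> cnt u = 2 * (u \in xs) + reached que u.
  by move=> un; rewrite cE // take_size addn0.
exists que; first by split=> // u un; rewrite mE // cE'.
by rewrite cE' //; case: (s \in xs); lia.
Qed.

Lemma wp_blizzard k : 50 * (n + m) <= k ->
  wp b blizzard (fun _ R _ => verdict (R rOut)) k (fun _ => 0) target.
Proof.
move=> lek; have lexs := size_xs.
apply: wp_seq; apply: wp_block => /=; first lia.
have [t0 t1 t2 t3] : [/\ target 0 = n, target 1 = m, target 2 = size xs & target 3 = s].
  by [].
rewrite t0 t1 t2 t3; discharge.
(* Kept for later: 18 per edge for linking, 14 for each of its two half-edges, 8 per vertex, and a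
   constant. Since [s < n] makes [n] positive, [50 * (n + m)] absorbs all constants. *)
apply: wp_seq; apply: wp_mono (@wp_enqueue_exits (46 * m + 8 * n + 8) _ _ _ _);
  last first.
  exists 0, (fun=> 0); split=> /=; rewrite ?take0 //; try by lia.
  - by split=> //; split=> //=; lia.
  - by split=> /=; lia.
  (* Memory past the input reads as the default 0, so empty lists and zero counters need no
     initialization. *)
  - have far i : F <= i -> target i = 0.
      by move=> lei; rewrite /target nth_default // size_input.
    by split=> // i Hi; rewrite far //; lia.
move=> k1 R M [[i [cnt [[lei _] [st RE] [RP' _ RT RH] mem cE]]] RP lek1].
have Ei : i = size xs by lia.
rewrite Ei take_size in RT mem cE.
apply: wp_seq; apply: wp_block => /=; first lia.
have [R1 RS RD RF RC] := st.
rewrite RP RF; discharge.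
apply: wp_seq; apply: wp_mono (@wp_link_edges (28 * m + 8 * n + 6) _ _ _ _);
  last first.
  exists 0, (fun=> 0), (fun=> 0), cnt; split=> //; first by lia.
  by split=> //=; lia.
move=> k2 R2 M2 [hd [nx [cnt2 [lek2 st2 [RT2 RH2] [mem2 ch] cE2]]]].
apply: wp_seq; apply: wp_block => /=; first lia.
rewrite RT2 RH2; discharge.
apply: wp_seq; apply: wp_mono (@wp_scan_queue 4 _ _ _ _); last first.
  exists 0, hd, nx, cnt2, xs; split=> //.
  - by rewrite take0 big_nil; lia.
  - by split=> //=; lia.
  split=> // [v|u un|u un|u]; first exact: (allP xs_lt).
  - by rewrite take0 /reached big_nil cE2 // !addn0.
  - by rewrite cE2 //; case: (u \in xs).
  - by left.
move=> k' R' M' [hd' [nx' [cnt' [que [lek' st' mem' bf]]]]].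
exact: wp_answer mem' bf.
Qed.

End Search.

(** * From numbers back to the vertices of the graph *)

(** As [a != b], at most one orientation can match, even when [u = v]; hence the sum is a truth
    value. *)
Lemma eq_set2 (T : finType) (a b u v : T) : a != b ->
  ((a, b) == (v, u)) + ((a, b) == (u, v)) = ([set a; b] == [set v; u]).
Proof.
move=> neq; rewrite !xpair_eqE; case: (altP ([set a; b] =P _)) => [E|nE].
  have: a \in [set v; u] by rewrite -E set21.
  have: b \in [set v; u] by rewrite -E set22.
  rewrite !inE => /orP[] /eqP Eb /orP[] /eqP Ea; move: neq; rewrite Ea Eb ?eqxx //.
    by rewrite eq_sym => /negPf ->; rewrite ?andbF.
  by move=> /negPf ->.
have -> : (a == v) && (b == u) = false.
  by apply/negP => /andP[/eqP Ea /eqP Eb]; rewrite Ea Eb eqxx in nE.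
have -> // : (a == u) && (b == v) = false.
by apply/negP => /andP[/eqP Ea /eqP Eb]; rewrite Ea Eb setUC eqxx in nE.
Qed.

Lemma count_gt1P (T : eqType) (P : pred T) (s : seq T) : uniq s ->
  reflect (exists a b, [/\ a != b, (a \in s) && P a & (b \in s) && P b])
    (1 < count P s).
Proof.
move=> us; rewrite -size_filter; apply: (iffP idP) => [|[a [b [neq aP bP]]]].
  have := filter_uniq P us; have mE x := mem_filter P x s; move: mE.
  case: [seq x <- s | P x] => [|a [|b l]] //= mE.
  rewrite inE negb_or => /andP[/andP[neq _] _] _; exists a, b.
  by split=> //; rewrite andbC -mE !inE eqxx ?orbT.
apply: (@uniq_leq_size _ [:: a; b]); first by rewrite /= inE neq.
by move=> x; rewrite !inE mem_filter andbC => /orP[] /eqP ->.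
Qed.

Section Encoding.
Variables (I : instance) (num : vertex (board I) -> nat).
Local Notation V := (vertex (board I)).
Local Notation Ed := (edges (board I)).
Variables (xs : seq V) (es : seq (V * V)).
Hypothesis num_inj : injective num.
Hypothesis num_lt : forall v, num v < #|V|.
Hypothesis xsE : perm_eq xs (enum (exits I)).
Hypothesis esE : perm_eq [seq [set uv.1; uv.2] | uv <- es] (enum Ed).

Local Notation nxs := [seq num x | x <- xs].
Local Notation nes := [seq (num uv.1, num uv.2) | uv <- es].

Lemma mem_xs v : (v \in xs) = (v \in exits I).
Proof. by rewrite (perm_mem xsE) mem_enum. Qed.

Lemma size_es : size es = #|Ed|.
Proof. by rewrite -(size_map (fun uv => [set uv.1; uv.2])) (perm_size esE) -cardE. Qed.

(** An injection of the vertices into [#|V|] numbers is onto, so the queue computed by the program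
    is a list of vertices. *)
Lemma num_seq (s : seq nat) : (forall k, k \in s -> k < #|V|) ->
  exists vs, s = [seq num v | v <- vs].
Proof.
have num_surj k : k < #|V| -> exists v, num v = k.
  move=> ltk; pose f v := Ordinal (num_lt v).
  have [g _ gK] : bijective f.
    by apply: inj_card_bij; [move=> u v /(congr1 val) /num_inj | rewrite card_ord].
  by exists (g (Ordinal ltk)); have := congr1 val (gK (Ordinal ltk)).
elim: s => [|k s IHs] ltn_s; first by exists [::].
have [v vk] : exists v, num v = k by apply: num_surj; apply: ltn_s; rewrite inE eqxx.
have [|vs ->] := IHs; first by move=> j js; apply: ltn_s; rewrite inE js orbT.
by exists (v :: vs); rewrite /= vk.
Qed.

Lemma count_pairs u v :
  count_mem (v, u) es + count_mem (u, v) es = ([set v; u] \in Ed).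
Proof.
have loopless : {in es, forall uv, uv.1 != uv.2}.
  move=> uv uv_in; apply: edge_neq; rewrite -mem_enum -(perm_mem esE).
  exact: (map_f (fun uv : V * V => [set uv.1; uv.2])).
rewrite -mem_enum -(perm_mem esE) -count_uniq_mem ?(perm_uniq esE) ?enum_uniq //.
elim: es loopless => //= -[a b] l IHl loopless.
rewrite addnACA IHl => [|uv uv_in]; last by apply: loopless; rewrite inE uv_in orbT.
by rewrite eq_set2 //; apply: (loopless (a, b)); rewrite inE eqxx.
Qed.

Lemma count_num_pairs u v :
  count_mem (num v, num u) nes = count_mem (v, u) es.
Proof.
rewrite count_map; apply: eq_count => -[a c] /=.
by rewrite !xpair_eqE !(inj_eq num_inj).
Qed.

Lemma reached_num n s vs u :
  reached n s nxs nes [seq num v | v <- vs] (num u) =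
  count (fun v => [set u; v] \in Ed) vs.
Proof.
rewrite /reached big_map; elim: vs => [|v vs IHvs]; first by rewrite big_nil.
rewrite big_cons IHvs count_adj !count_num_pairs /= setUC; congr (_ + _).
exact: count_pairs.
Qed.

Lemma encoding_input : input #|V| (num (start I)) nxs nes =
  [:: #|V|; size es; size xs; num (start I)]
  ++ [seq num x | x <- xs] ++ flatten [seq [:: num uv.1; num uv.2] | uv <- es].
Proof. by rewrite /input !size_map -map_comp. Qed.

Lemma verdict_winner out : verdict #|V| (num (start I)) nxs nes out ->
  exists winner, (forall P, has_winning_strategy I P <-> P = winner) /\
    out = player_code winner.
Proof.
case=> que [uq ltq memq rankq] ->.
have [vs Eq] := num_seq ltq; subst que.
rewrite (map_inj_uniq num_inj) in uq.
have {}memq u : (u \in vs) =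
    (1 < 2 * (u \in exits I) + count (fun v => [set u; v] \in Ed) vs).
  rewrite -(mem_map num_inj) memq; last exact: num_lt.
  by rewrite (mem_map num_inj) mem_xs reached_num.
have {}rankq u : u \in vs -> u \in exits I \/
    1 < count (fun v => [set u; v] \in Ed) (take (index u vs) vs).
  rewrite -(mem_map num_inj) => /rankq.
  by rewrite (mem_map num_inj) mem_xs (index_map num_inj) -map_take reached_num.
rewrite (mem_map num_inj) mem_xs reached_num -has_count.
(* The rank of a vertex of [W] is its position in the queue. *)
pose W := [set v in vs].
have exitsW : exits I \subset W.
  by apply/subsetP => x xx; rewrite inE memq xx.
have rank_pair v : v \in W -> v \notin exits I ->
    exists u1 u2, [/\ u1 != u2,
    [&& u1 \in W, index u1 vs < index v vs & [set v; u1] \in Ed] &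
    [&& u2 \in W, index u2 vs < index v vs & [set v; u2] \in Ed]].
  rewrite inE => /rankq[->//|] /(count_gt1P _ (take_uniq _ uq)).
  move=> [a [c [neq /andP[a_in va] /andP[c_in vc]]]] _; exists a, c; split=> //.
    by rewrite inE (mem_take a_in) index_ltn.
  by rewrite inE (mem_take c_in) index_ltn.
have closedW v u1 u2 : v \notin W -> u1 \in W -> u2 \in W ->
    [set v; u1] \in Ed -> [set v; u2] \in Ed -> u1 = u2.
  rewrite !inE memq -leqNgt => le1 u1W u2W vu1 vu2.
  (* Two distinct neighbours in [W] would bring the count to 2 and put [v] in the queue. *)
  apply/eqP; apply: contraTT le1 => neq; rewrite -ltnNge.
  apply: leq_trans (leq_addl _ _); apply/(count_gt1P _ uq).
  by exists u1, u2; rewrite u1W u2W vu1 vu2.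
have -> : has (fun v => [set start I; v] \in Ed) vs =
    [exists u in W, [set start I; u] \in Ed].
  by apply/hasP/exists_inP => -[u uvs su]; exists u; rewrite ?inE // in uvs *.
case: (boolP (_ || _)) => win; [exists Trapper | exists Storm]; split=> // P.
- have wins := trapper_wins rank_pair win.
  by case: P; split=> // /(winning_strategy_excl wins).
- have wins := storm_wins exitsW closedW win.
  by case: P; split=> // /winning_strategy_excl /(_ wins).
Qed.

End Encoding.

(* [N.+1 ^ k] as a bound on the words means words of O(log N) bits. *)
Theorem theorem2 :
  exists (prog : program) (c k : nat), forall (I : instance) (w : seq nat),
    encodes I w ->
    exists winner : player,
      (forall P : player, has_winning_strategy I P <-> P = winner) /\
      computes prog (c * graph_size (board I)) ((graph_size (board I)).+1 ^ k)
        w (player_code winner).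
Proof.
exists (compile 0 blizzard), 50, 4 => I w [num [xs [es [inj lt_num xsE esE ->]]]].
rewrite -encoding_input; set V := vertex (board I) in num xs es inj lt_num xsE esE *.
set nxs := [seq num x | x <- xs]; set nes := [seq (num uv.1, num uv.2) | uv <- es].
have sizeE : size nes = #|edges (board I)| by rewrite size_map; apply: size_es.
have xs_lt : all (ltn^~ #|V|) nxs by rewrite all_map; apply/allP => x _; apply: lt_num.
have xs_uniq : uniq nxs by rewrite map_inj_uniq // (perm_uniq xsE) enum_uniq.
have es_lt : all (fun e => (e.1 < #|V|) && (e.2 < #|V|)) nes.
  by rewrite all_map; apply/allP => e _ /=; rewrite !lt_num.
have V_gt0 : 0 < #|V| by apply/card_gt0P; exists (start I).
have sizeG : graph_size (board I) = #|V| + size nes by rewrite sizeE.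
(* The start vertex makes the graph size N positive, so 8 is at most [N.+1 ^ 3]; hence the exponent
   4. *)
have b_large : 8 * (#|V| + size nes).+1 <= (graph_size (board I)).+1 ^ 4.
  rewrite sizeG [_ ^ 4]expnSr leq_mul2r; apply/orP; right.
  by rewrite (@leq_exp2r 2 _ 3); lia.
have word_le : all (leq^~ ((graph_size (board I)).+1 ^ 4))
    (input #|V| (num (start I)) nxs nes).
  have words_le k : k <= #|V| + size nes -> k <= (graph_size (board I)).+1 ^ 4.
    by lia.
  have num_le v : num v <= #|V| + size nes.
    by apply: leq_trans (leq_addr _ _); apply: ltnW.
  apply/allP => k; rewrite /input !mem_cat !inE => /orP[|/orP[]].
  - case/or4P=> /eqP ->; apply: words_le => //; rewrite ?leq_addr ?leq_addl //.
    by apply: leq_trans (leq_addr _ _); apply: size_xs.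
  - by move=> /mapP[v _ ->]; apply: words_le.
  move=> /flattenP[_ /mapP[_ /mapP[uv _ ->] ->]]; rewrite !inE /=.
  by case/orP=> /eqP ->; apply: words_le.
have [out vout cout] := wp_computes word_le
  (wp_blizzard xs_lt xs_uniq es_lt (lt_num (start I)) b_large (leqnn _)).
have [winner [winP outE]] := verdict_winner inj lt_num xsE esE vout.
by exists winner; split=> //; rewrite -outE [X in 50 * X]sizeG.
Qed.
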